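(* Let $k\in\mathbb{N}_0$, $n\geq 2$ and $\alpha\in(0,1)$. Let $F$ be the distribution function of a random variable $X$ taking values in $[0,1]$, let $Y_n$ be the empirical distribution function of a sample of size $n$ from $X$, and assume that $F\in C^{k}[0,1]$. For an integer $m>\max(k,1)$ put $$l_{k,\alpha}(m)=2^k(m)_k\sqrt{2\log(2/\alpha)}.$$ Let $m>\max(k,1)$ be the first positive integer such that $$\left\|\frac{(m)_k}{m^k}B_{m,k}(F^{(k)};x)-F^{(k)}(x)\right\|\leq \frac{1}{2}\,l_{k,\alpha}(m)\,\frac{1}{\sqrt{n}}.$$ Then $$P\left(\left\|B_m^{(k)}(Y_n;x)-F^{(k)}(x)\right\|>\frac{l_{k,\alpha}(m)}{\sqrt{n}}\right)\leq\alpha.$$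
   Context: $\|\cdot\|$ is the supremum norm over $x\in[0,1]$. $C^k[0,1]$ is the set of $k$ times continuously differentiable functions on $[0,1]$, with $C^0[0,1]=C[0,1]$ (here $F\in C^k[0,1]$ refers to $F$ restricted to $[0,1]$); $\mathbb{N}_0=\{0,1,2,\dots\}$. The falling factorial is $(m)_k=m(m-1)\cdots(m-k+1)$, $(m)_0=1$. Empirical distribution function: $Y_n(x)=\frac1n\sum_{r=1}^n 1_{(-\infty,x]}(X_r)$, $x\in[0,1]$, where $X_1,\dots,X_n$ are independent copies of $X$ on a probability space with probability $P$. Bernstein polynomial: for $f:[0,1]\to\mathbb{R}$, $B_m(f;x)=\sum_{j=0}^m f(j/m)\binom{m}{j}x^j(1-x)^{m-j}$. Thus $B_m(Y_n;x)$ is a random polynomial in $x$, and $B_m^{(k)}(Y_n;x)$ is its $k$-th derivative with respect to $x$. Bernstein-Kantorovich operator: for $f\in C[0,1]$, $m>k$, $x\in[0,1]$, $$B_{m,k}(f;x)=\widetilde{\mathbb{E}}f\left(\frac{\widetilde S_{m-k}(x)+\widetilde V_1+\dots+\widetilde V_k}{m}\right),$$ where $\widetilde S_{m-k}(x)$ is binomial with parameters $m-k$ and $x$, $\widetilde V_1,\dots,\widetilde V_k$ are uniform on $[0,1]$, all these variables are mutually independent, and $\widetilde{\mathbb{E}}$ is expectation with respect to them; in particular $B_{m,0}=B_m$. *)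

(* Defs.v *)
From HB Require Import structures.
From mathcomp Require Import all_boot all_order all_algebra.
From mathcomp Require Import all_classical all_reals all_analysis.

Set Implicit Arguments.
Unset Strict Implicit.
Unset Printing Implicit Defensive.

Import Order.TTheory GRing.Theory Num.Theory.
Import numFieldNormedType.Exports.

Local Open Scope classical_set_scope.
Local Open Scope ring_scope.

Section Calculus.
Context {R : realType}.
Implicit Types (f : R -> R) (x : R).

(* Extended-real valued, so that an unbounded function has norm +oo rather than
   the default value of a real supremum. *)
Definition supnorm01 f : \bar R :=
  ereal_sup [set (`|f x|)%:E | x in `[0, 1]].

(* Difference quotients only use points of [0, 1]: the derivatives at 0 and 1
   are one-sided, and the values of f outside [0, 1] are irrelevant. *)
Definition quotient01 f x : R -> R := fun y => (f y - f x) / (y - x).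

Definition derivable01 f x : Prop :=
  cvg (quotient01 f x y @[y --> within `[0, 1] x^']).

Definition derive01 f : R -> R :=
  fun x => lim (quotient01 f x y @[y --> within `[0, 1] x^']).

Definition derive01n (k : nat) f : R -> R := iter k derive01 f.

Definition C01 (k : nat) f : Prop :=
  (forall i x, (i < k)%N -> x \in `[0, 1] -> derivable01 (derive01n i f) x) /\
  {within `[0, 1], continuous (derive01n k f)}.

Definition bernstein (m : nat) f : R -> R := fun x =>
  \sum_(j < m.+1) f (j%:R / m%:R) * 'C(m, j)%:R * x ^+ j * (1 - x) ^+ (m - j).

End Calculus.

Section TupleProduct.
Context {d} {T : measurableType d} {R : realType}.

Definition tcons (n : nat) (p : T * n.-tuple T) : n.+1.-tuple T :=
  [the n.+1.-tuple T of p.1 :: p.2].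

Fact measurable_tcons (n : nat) : measurable_fun setT (@tcons n).
Proof. exact: measurable_cons. Qed.

HB.instance Definition _ (n : nat) :=
  isMeasurableFun.Build _ _ _ _ (@tcons n) (@measurable_tcons n).

(* The joint law of n independent random variables of law P. *)
Fixpoint iid_prob (P : probability T R) (n : nat) :
    probability (n.-tuple T) R :=
  match n with
  | 0 => \d_([tuple] : 0.-tuple T)
  | n'.+1 => distribution (P \x iid_prob P n')%E (@tcons n')
  end.

End TupleProduct.

Section Kantorovich.
Context {R : realType}.

(* The joint law of the independent variables S_{m-k}(x) and (V_1, ..., V_k). *)
Definition kantorovich_prob (m k : nat) (x : R) :
    probability (nat * k.-tuple (measurableTypeR R))%type R :=
  (binomial_prob (m - k) x \x iid_prob (uniform_prob (@ltr01 R)) k)%E.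

(* f is only meaningful on [0, 1], which contains the argument almost surely;
   it is extended by 0. *)
Definition kantorovich (m k : nat) (f : R -> R) : R -> R := fun x =>
  fine ('E_(kantorovich_prob m k x)
    [fun w => (f \_ `[0, 1])
       ((w.1%:R + \sum_(i < k) (tnth w.2 i : R)) / m%:R)]).

End Kantorovich.

Section Sampling.
Context {d} {T : measurableType d} {R : realType} (P : probability T R).

Definition mutually_independent (n : nat) (X : 'I_n -> {RV P >-> R}) : Prop :=
  forall (J : {set 'I_n}) (A : 'I_n -> set R),
    (forall i, measurable (A i)) ->
    P (\bigcap_(i in [set` J]) X i @^-1` A i) =
    (\prod_(i in J) P (X i @^-1` A i))%E.

Definition ecdf (n : nat) (X : 'I_n -> {RV P >-> R}) (w : T) : R -> R :=
  fun x => n%:R^-1 * \sum_(r < n) \1_(`]-oo, x]) (X r w).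

End Sampling.

(* The variable X0 may live on another probability space; laws are compared on
   measurable sets only. *)
Definition independent_copies {d d0} {T : measurableType d}
    {T0 : measurableType d0} {R : realType}
    (P : probability T R) (P0 : probability T0 R) (X0 : {RV P0 >-> R})
    (n : nat) (X : 'I_n -> {RV P >-> R}) : Prop :=
  mutually_independent X /\
  forall i (A : set R), measurable A ->
    distribution P (X i) A = distribution P0 X0 A.

Definition threshold {R : realType} (k : nat) (alpha : R) (m : nat) : R :=
  2 ^+ k * (m ^_ k)%:R * Num.sqrt (2 * ln (2 / alpha)).

Definition bias_small {R : realType} (k n : nat) (alpha : R) (F : R -> R)
    (m : nat) : Prop :=
  (supnorm01 (fun x => (m ^_ k)%:R / m%:R ^+ k
                         * kantorovich m k (derive01n k F) x
                       - derive01n k F x)%R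
   <= (2^-1 * threshold k alpha m / Num.sqrt n%:R)%R%:E)%E.

(* Main.v *)
(* Writing B_m^{(k)}(g; x) = (m)_k sum_j D^k g(j/m) b_{m-k,j}(x), with D^k the
   k-th forward difference of step 1/m, shows that the estimation error is at
   most 2^k (m)_k max_j |Y_n(j/m) - F(j/m)| plus the bias of B_m^{(k)}(F), and
   the fundamental theorem of calculus, iterated, identifies B_m^{(k)}(F) with
   (m)_k / m^k B_{m,k}(F^{(k)}).  What remains is the
   Dvoretzky-Kiefer-Wolfowitz inequality with Massart's constant at the grid
   points: P(max_j |Y_n - F| >= e) <= 2 exp(-2 n e^2).

   For the latter let N_j be the number of observations below the j-th grid
   point and F_j the probability of one such observation.  Read from right to
   left, (1 + c/F_j)^{N_j} is a martingale for every c > 0, so stopping it at the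
   largest j with N_j >= n (F_j + e) bounds the probability of such a j by
   (1 + c)^n / inf_x (1 + c/x)^{n (x + e)}.  With t = 4e, s = exp t - 1 and
   c chosen so that the infimum is attained at x = c/s, Hoeffding's lemma for a
   Bernoulli(c/s) variable turns this into exp(-2 n e^2).  The lower deviations
   follow by reversing the order of the grid. *)

Require Import Defs.
From mathcomp Require Import all_boot all_order all_algebra.
From mathcomp Require Import all_classical all_reals all_analysis measurable_realfun.
From mathcomp Require Import ring lra zify.

Set Implicit Arguments.
Unset Strict Implicit.
Unset Printing Implicit Defensive.

Import Order.TTheory GRing.Theory Num.Theory.
Import numFieldNormedType.Exports.

Local Open Scope classical_set_scope.
Local Open Scope ring_scope.

(** * A maximal inequality for multinomial counts *)

Section FiniteBallot.
Context {R : realFieldType} (N n : nat).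
Implicit Types (j : 'I_N.+1) (g : {ffun 'I_n -> 'I_N.+1}) (p : 'I_N.+1 -> R).

(** Lumping forgets where a value lies inside the cells [0, ..., j]; summing over the fibres of
    [lumpf j] acts as conditional expectation given the process read from the right down to [j]. *)
Definition lump j (i : 'I_N.+1) : 'I_N.+1 := if (i <= j)%N then j else i.

Definition lumpf j g := [ffun r => lump j (g r)].

Definition rank j g : nat := #|[pred r | (g r <= j)%N]|.

Lemma lump_le j i (l : 'I_N.+1) : (j <= l)%N -> (lump j i <= l)%N = (i <= l)%N.
Proof.
move=> jl; rewrite /lump; case: ifPn => // ij.
by rewrite jl (leq_trans ij jl).
Qed.

Lemma rank_lumpf j g (l : 'I_N.+1) : (j <= l)%N -> rank l (lumpf j g) = rank l g.
Proof.
by move=> jl; apply: eq_card => r; rewrite !inE ffunE lump_le.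
Qed.

Lemma lumpfK j g : lumpf j (lumpf j g) = lumpf j g.
Proof.
apply/ffunP => r; rewrite !ffunE /lump.
by case: (leqP (g r) j) => [|h]; rewrite ?leqnn // leqNgt h.
Qed.

(** Within a fibre of [lumpf j] the coordinates vary independently, so the sum of products over the
    fibre factors into a product of sums. *)
Lemma sum_lump p (Q : pred {ffun 'I_n -> 'I_N.+1}) j :
  (forall g, Q (lumpf j g) = Q g) ->
  \sum_(g | Q g) \prod_r p (g r) =
  \sum_(h | Q h && (lumpf j h == h)) \prod_r \sum_(i | lump j i == h r) p i.
Proof.
move=> QE.
rewrite (partition_big (lumpf j) (fun h => Q h && (lumpf j h == h))) /=; last first.
  by move=> g Qg; rewrite QE Qg lumpfK eqxx.
apply: eq_bigr => h /andP[Qh _].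
rewrite (bigA_distr_big_dep (fun r i => lump j i == h r) (fun=> p)) /=.
apply: eq_bigl => g.
apply/andP/familyP => [[_ /eqP <-] r|H]; first by rewrite unfold_in /= ffunE.
have gh : lumpf j g = h by apply/ffunP => r; rewrite ffunE; apply/eqP/H.
by rewrite gh eqxx -QE gh.
Qed.

Variables (p : 'I_N.+1 -> R) (c eps K : R).
Hypotheses (p0 : forall i, 0 <= p i) (p1 : \sum_i p i = 1).
Hypotheses (c0 : 0 <= c) (K0 : 0 <= K).

Definition mass j : R := \sum_(i < N.+1 | (i <= j)%N) p i.

(** With [x] the mass and [a] the count at a crossing, this says [K <= (1 + c / x) ^+ a], a lower
    bound for the stopped martingale. The denominator is cleared so that [x = 0] is allowed. *)
Hypothesis HK : forall (x : R) (a : nat), 0 <= x <= 1 ->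
  n%:R * (x + eps) <= a%:R -> K * x ^+ a <= (x + c) ^+ a.

Definition crossing j g := n%:R * (mass j + eps) <= (rank j g)%:R.

(** Read from right to left this is the first crossing, hence a stopping time. *)
Definition last_crossing j g :=
  crossing j g && [forall l : 'I_N.+1, (j < l)%N ==> ~~ crossing l g].

(* Adding the mass [c] to the leftmost cell plays the role of the terminal value
   of the reversed martingale [(1 + c / F_j) ^ N_j]. *)
Let tilt i := p i + c * (i == ord0)%:R.

Lemma last_crossing_lumpf j g : last_crossing j (lumpf j g) = last_crossing j g.
Proof.
rewrite /last_crossing /crossing rank_lumpf //; congr (_ && _).
by apply: eq_forallb => l; case: ltnP => //= jl; rewrite rank_lumpf // ltnW.
Qed.

Lemma lump_eq j i : (lump j i == j) = (i <= j)%N.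
Proof.
rewrite /lump; case: ifPn => [|ij]; first by rewrite eqxx.
by apply/eqP => E; rewrite E leqnn in ij.
Qed.

Lemma mass_ge0 j : 0 <= mass j. Proof. exact: sumr_ge0. Qed.

Lemma mass_le1 j : mass j <= 1.
Proof.
by rewrite -p1 [leRHS](bigID (fun i : 'I_N.+1 => (i <= j)%N)) /= lerDl sumr_ge0.
Qed.

(* [last_crossing j g] does not see how [g] distributes its values inside the
   cells [0, ..., j]; summing them out leaves the weight [mass j] or, after
   tilting, [mass j + c] for each of the [rank j g] points concerned. *)
Lemma tilt_last_crossing j :
  K * (\sum_(g | last_crossing j g) \prod_r p (g r)) <=
  \sum_(g | last_crossing j g) \prod_r tilt (g r).
Proof.
rewrite !(@sum_lump _ _ j (last_crossing_lumpf j)) mulr_sumr.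
apply: ler_sum => h /andP[/andP[cr _] /eqP hE].
have rankE : rank j h = #|[pred r | h r == j]|.
  by apply: eq_card => r; rewrite !inE -{2}hE ffunE lump_eq.
rewrite (bigID (fun r => h r == j)) /= [leRHS](bigID (fun r => h r == j)) /=.
rewrite mulrA; apply: ler_pM.
- by rewrite mulr_ge0 // prodr_ge0 // => r _; apply: sumr_ge0.
- by rewrite prodr_ge0 // => r _; apply: sumr_ge0.
- rewrite (eq_bigr (fun=> mass j)); last first.
    by move=> r /eqP ->; apply: eq_bigl => i; rewrite lump_eq.
  rewrite [leRHS](eq_bigr (fun=> mass j + c)); last first.
    move=> r /eqP ->; rewrite (eq_bigl _ _ (lump_eq j)) big_split /=.
    congr (_ + _); rewrite (bigD1 ord0) //= big1 ?eqxx ?mulr1 ?addr0 //.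
    by move=> i /andP[_ /negPf ->]; rewrite mulr0.
  rewrite !prodr_const -rankE; apply: HK => //.
  by rewrite mass_ge0 mass_le1.
- apply: ler_prod => r _; rewrite sumr_ge0 //=.
  by apply: ler_sum => i _; rewrite lerDl mulr_ge0.
Qed.

(** Optional stopping in finite form: the position of the last crossing partitions the event, each
    piece gains at least a factor [K] under the tilted weights, and these have total mass
    [(1 + c) ^+ n]. *)
Lemma crossing_sum :
  K * (\sum_(g | [exists j, crossing j g]) \prod_r p (g r)) <= (1 + c) ^+ n.
Proof.
have tilt0 i : 0 <= tilt i by rewrite addr_ge0 ?mulr_ge0.
have ex_last g : [exists j, crossing j g] -> exists j, last_crossing j g.
  move=> /existsP[j0 cj0].
  case: (@arg_maxnP _ j0 (crossing^~ g) (@nat_of_ord _) cj0) => j cj jmax.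
  exists j; rewrite /last_crossing cj; apply/forallP => l; apply/implyP => jl.
  by apply: contraL jl => /jmax; rewrite -leqNgt.
have last_uniq g j l : last_crossing j g -> last_crossing l g -> j = l.
  move=> /andP[cj /forallP uj] /andP[cl /forallP ul]; apply/val_inj/eqP.
  rewrite eqn_leq; apply/andP; split; rewrite leqNgt; apply/negP => lt.
    by have := implyP (ul j) lt; rewrite cj.
  by have := implyP (uj l) lt; rewrite cl.
have split_last (q : 'I_N.+1 -> R) : \sum_(g | [exists j, crossing j g]) \prod_r q (g r) =
    \sum_j \sum_(g | last_crossing j g) \prod_r q (g r).
  rewrite [RHS](exchange_big_dep (fun g => [exists j, crossing j g])) /=; last first.
    by move=> j g _ /andP[cj _]; apply/existsP; exists j.
  apply: eq_bigr => g /ex_last[j lj].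
  by rewrite (big_pred1 j) // => l /=; apply/idP/eqP => [ll|->//]; apply: last_uniq ll lj.
rewrite split_last mulr_sumr.
apply: (@le_trans _ _ (\sum_(g : {ffun 'I_n -> 'I_N.+1}) \prod_r tilt (g r))).
  rewrite [leRHS](bigID (fun g => [exists j, crossing j g])) /= split_last.
  rewrite -[leLHS]addr0; apply: lerD; last first.
    by apply: sumr_ge0 => g _; apply: prodr_ge0.
  by apply: ler_sum => j _; apply: tilt_last_crossing.
rewrite -(bigA_distr_bigA (fun (_ : 'I_n) i => tilt i)) prodr_const card_ord.
rewrite big_split /= p1 (bigD1 ord0) //= big1 ?eqxx ?mulr1 ?addr0 //.
by move=> i /negPf ->; rewrite mulr0.
Qed.

End FiniteBallot.

(** * The sharp exponent *)

Section Calculus.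
Context {R : realType}.
Implicit Types (f df : R -> R) (a b : R).

Lemma is_derive_MVT f df a b : a < b ->
  (forall x, a <= x <= b -> is_derive x 1 f (df x)) ->
  exists2 x, a < x < b & f b - f a = df x * (b - a).
Proof.
move=> ab Hf.
have Hf' x : x \in `]a, b[ -> is_derive x 1 f (df x).
  by rewrite in_itv /= => /andP[ax xb]; apply: Hf; rewrite !ltW.
have [|x] := MVT ab Hf'.
  apply: derivable_within_continuous => x; rewrite in_itv /= => /Hf H.
  exact: ex_derive.
by rewrite in_itv /=; exists x.
Qed.

Lemma is_derive_ge0_le f df a b : a <= b ->
  (forall x, a <= x <= b -> is_derive x 1 f (df x)) ->
  (forall x, a <= x <= b -> 0 <= df x) -> f a <= f b.
Proof.
rewrite le_eqVlt => /predU1P[-> //|ab] Hf Hdf.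
have [x /andP[ax xb] E] := is_derive_MVT ab Hf.
by rewrite -subr_ge0 E mulr_ge0 ?subr_ge0 ?(ltW ab) // Hdf // !ltW.
Qed.

Lemma is_derive_le0_ge f df a b : a <= b ->
  (forall x, a <= x <= b -> is_derive x 1 f (df x)) ->
  (forall x, a <= x <= b -> df x <= 0) -> f b <= f a.
Proof.
move=> ab Hf Hdf; rewrite -lerN2.
apply: (@is_derive_ge0_le (- f) (fun x => - df x) a b ab) => x H.
  by have := Hf x H => ?; apply: is_deriveN.
by rewrite oppr_ge0 Hdf.
Qed.

(* Hoeffding's lemma for a Bernoulli variable. *)
Lemma ln_bernoulli_mgf (x t : R) : 0 <= x -> 0 <= t ->
  ln (1 + x * (expR t - 1)) <= t * x + t ^+ 2 / 8.
Proof.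
move=> x0 t0.
pose D y := 1 + x * (expR y - 1).
have D0 (y : R) : 0 <= y -> 0 < D y.
  move=> y0; rewrite ltr_pwDl // mulr_ge0 // subr_ge0.
  by rewrite (le_trans _ (expR_ge1Dx y)) // lerDl.
pose f y := y * x + y ^+ 2 / 8 - ln (D y).
pose g y := x + y / 4 - x * expR y / D y.
have dD (y : R) : is_derive y 1 D (x * expR y).
  by apply: is_derive_eq; rewrite /GRing.scale /=; ring.
have df (y : R) : 0 <= y -> is_derive y 1 f (g y).
  move=> y0; have := is_derive1_ln (D0 _ y0) => dln.
  have : is_derive y 1 (fun z => ln (D z)) ((D y)^-1 * (x * expR y)).
    exact: is_derive1_comp.
  move=> dlnD; rewrite /f; apply: is_derive_eq.
  by rewrite /g /GRing.scale /=; field; rewrite gt_eqF ?D0.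
have dg (y : R) : 0 <= y ->
    is_derive y 1 g (4^-1 - x * expR y / D y * (1 - x * expR y / D y)).
  move=> y0; have Dn0 : D y != 0 by rewrite gt_eqF ?D0.
  have dV : is_derive y 1 (fun z => (D z)^-1) (- (D y) ^- 2 * (x * expR y)).
    exact: (is_deriveV Dn0 (dD y)).
  rewrite /g; apply: is_derive_eq.
  by rewrite /GRing.scale /=; field.
have g0 (y : R) : 0 <= y -> 0 <= g y.
  move=> y0; have gg : g 0 <= g y.
    apply: (is_derive_ge0_le y0 (fun z h => dg z (proj1 (andP h)))) => z _.
    (* With [v = x * expR z / D z], the derivative of [g] is [1/4 - v (1 - v) = (v - 1/2)^2]. *)
    set v := (X in X * (1 - X)); have : 0 <= (v - 2^-1) ^+ 2 by exact: sqr_ge0.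
    nra.
  apply: le_trans gg.
  by rewrite /g /D expR0 subrr mulr0 !addr0 mul0r divr1 mulr1 addr0 subrr.
have f0 : f 0 <= f t.
  apply: (@is_derive_ge0_le f g 0 t t0) => [z|z] /andP[z0 _]; first exact: df.
  exact: g0.
move: f0; rewrite /f /D expR0 subrr mulr0 addr0 ln1 mul0r; lra.
Qed.

(* With [s = c / x] the function [x |-> (x + eps) ln (1 + c / x)] has derivative
   [q s / s ^ 2] in [s], where [q] vanishes at [0] and, by the choice of [c], at
   [s0], and first decreases, then increases. *)
Lemma tilt_min (c eps s0 : R) : 0 < eps -> 0 < s0 ->
  c * ln (1 + s0) = (c * s0 + eps * s0 ^+ 2) / (1 + s0) ->
  forall s : R, 0 < s ->
  (c / s0 + eps) * ln (1 + s0) <= (c / s + eps) * ln (1 + s).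
Proof.
move=> e0 s00 Hc s sp.
pose q y := (c * y + eps * y ^+ 2) / (1 + y) - c * ln (1 + y).
pose dq y := y * (2 * eps - c + eps * y) / (1 + y) ^+ 2.
have D0 (y : R) : 0 <= y -> 0 < 1 + y by move=> y0; rewrite ltr_pwDl.
have dln (y : R) : 0 <= y -> is_derive y 1 (fun z => ln (1 + z)) (1 + y)^-1.
  move=> y0; have := is_derive1_ln (D0 _ y0) => d1.
  have d2 : is_derive y 1 (fun z : R => 1 + z) 1.
    by apply: is_derive_eq; rewrite add0r mulr1.
  by rewrite -[X in is_derive _ _ _ X]mulr1; exact: is_derive1_comp.
have qD (y : R) : 0 <= y -> is_derive y 1 q (dq y).
  move=> y0; have Dn0 : 1 + y != 0 by rewrite gt_eqF ?D0.
  have d2 : is_derive y 1 (fun z : R => 1 + z) 1.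
    by apply: is_derive_eq; rewrite add0r mulr1.
  have dV : is_derive y 1 (fun z => (1 + z)^-1) (- (1 + y) ^- 2 * 1).
    exact: (is_deriveV Dn0 d2).
  have := dln y y0 => dl; rewrite /q; apply: is_derive_eq.
  by rewrite /dq /GRing.scale /=; field.
have q0 : q 0 = 0 by rewrite /q !addr0 ln1; ring.
have qs0 : q s0 = 0 by rewrite /q Hc subrr.
(* Rolle's theorem: [q] vanishes at [0] and [s0], so [dq] has a zero [s1] in between. This forces
   [c = 2 eps + eps s1], and [dq y] then has the sign of [y - s1]. *)
have [s1 /andP[s10 s1s] /eqP] : exists2 x, 0 < x < s0 & q s0 - q 0 = dq x * (s0 - 0).
  apply: (@is_derive_MVT q dq 0 s0 s00) => y /andP[y0 _]; exact: qD.
rewrite q0 qs0 !subr0 eq_sym mulf_eq0 (gt_eqF s00) orbF /dq.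
rewrite mulf_eq0 invr_eq0 sqrf_eq0 (gt_eqF (D0 _ (ltW s10))) orbF.
rewrite mulf_eq0 (gt_eqF s10) /= => /eqP cE.
have {}cE : c = 2 * eps + eps * s1 by lra.
have dqE (y : R) : dq y = y * (eps * (y - s1)) / (1 + y) ^+ 2.
  by rewrite /dq cE; congr (_ / _); ring.
have dq_ge0 (y : R) : s1 <= y -> 0 <= dq y.
  move=> sy; rewrite dqE divr_ge0 ?sqr_ge0 // !mulr_ge0 ?subr_ge0 // ?(ltW e0) //.
  by apply: le_trans sy; apply: ltW.
have dq_le0 (y : R) : 0 <= y <= s1 -> dq y <= 0.
  move=> /andP[y0 ys]; rewrite dqE -(opprB s1) !mulrN mulNr oppr_le0.
  by rewrite divr_ge0 ?sqr_ge0 // !mulr_ge0 ?subr_ge0 // ltW.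
have q_le0 (y : R) : 0 <= y <= s0 -> q y <= 0.
  move=> /andP[y0 ys0]; have [ys|/ltW ys] := leP y s1.
    rewrite -q0; apply: (@is_derive_le0_ge q dq 0 y y0) => z /andP[z0 zy]; first exact: qD.
    by apply: dq_le0; rewrite z0 (le_trans zy).
  rewrite -qs0; apply: (@is_derive_ge0_le q dq y s0 ys0) => z /andP[yz zs].
    by apply: qD; apply: le_trans yz.
  by apply: dq_ge0; apply: le_trans yz.
have q_ge0 (y : R) : s0 <= y -> 0 <= q y.
  move=> sy; rewrite -qs0; apply: (@is_derive_ge0_le q dq s0 y sy) => z /andP[sz zy].
    by apply: qD; apply: le_trans sz; apply: ltW.
  by apply: dq_ge0; apply: le_trans sz; apply: ltW.
pose H y := (c / y + eps) * ln (1 + y).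
pose dH y := q y / y ^+ 2.
have HD (y : R) : 0 < y -> is_derive y 1 H (dH y).
  move=> y0; have yn0 : y != 0 by rewrite gt_eqF.
  have Dn0 : 1 + y != 0 by rewrite gt_eqF ?D0 // ltW.
  have dV : is_derive y 1 (fun z => z^-1) (- y ^- 2 * 1).
    exact: (is_deriveV yn0 (is_derive_id y 1)).
  have := dln y (ltW y0) => dl; rewrite /H; apply: is_derive_eq.
  by rewrite /dH /q /GRing.scale /=; field; rewrite yn0.
(* The sign of [q] makes [H] nonincreasing up to [s0] and nondecreasing afterwards. *)
rewrite -/(H s0) -/(H s); have [ss0|/ltW ss0] := leP s s0.
  apply: (@is_derive_le0_ge H dH s s0 ss0) => z /andP[sz zs].
    by apply: HD; apply: lt_le_trans sz.
  rewrite -oppr_ge0 -mulNr divr_ge0 ?sqr_ge0 // oppr_ge0 q_le0 // zs andbT.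
  by rewrite (le_trans (ltW sp)).
apply: (@is_derive_ge0_le H dH s0 s ss0) => z /andP[sz zs].
    by apply: HD; apply: lt_le_trans sz.
by rewrite divr_ge0 ?sqr_ge0 ?q_ge0.
Qed.

Lemma tilt_exists (eps : R) : 0 < eps ->
  exists2 c, 0 < c & forall x, 0 < x ->
    2 * eps ^+ 2 + ln (1 + c) <= (x + eps) * ln (1 + c / x).
Proof.
(* This [t] maximises [eps t - t^2 / 8], with maximum [2 eps^2]. *)
move=> e0; pose t := 4 * eps; pose s := expR t - 1.
have t0 : 0 < t by rewrite mulr_gt0.
have sE : 1 + s = expR t by rewrite addrC subrK.
have s0 : 0 < s by rewrite subr_gt0 expR_gt1.
have d0 : 0 < expR t * t - s.
  have : 1 - t < expR (- t) by rewrite expR_gt1Dx // oppr_eq0 gt_eqF.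
  rewrite expRN -(@ltr_pM2l _ (expR t)) ?expR_gt0 // mulfV ?gt_eqF ?expR_gt0 //.
  by rewrite /s; lra.
(* The condition of [tilt_min] at [s0 = s] is linear in [c]; this is its solution. *)
pose c := eps * s ^+ 2 / (expR t * t - s).
have c0 : 0 < c by rewrite divr_gt0 ?mulr_gt0 ?exprn_gt0.
exists c => // x x0.
have cx0 : 0 < c / x by rewrite divr_gt0.
have := @tilt_min c eps s e0 s0 _ _ cx0.
have -> : c / (c / x) = x by rewrite invf_div mulrCA divff ?mulr1 // gt_eqF.
rewrite sE expRK => H.
have {}H : (c / s + eps) * t <= (x + eps) * ln (1 + c / x).
  apply: H; rewrite /c; field.
  by rewrite !gt_eqF ?expR_gt0.
apply: le_trans H.
(* Since [(c / s) (expR t - 1) = c], Hoeffding's lemma bounds [ln (1 + c)] by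
   [t c / s + t^2 / 8]. *)
have := @ln_bernoulli_mgf (c / s) t (ltW (divr_gt0 c0 s0)) (ltW t0).
rewrite -/s divfK ?gt_eqF // /t => H.
apply: (le_trans (lerD (lexx _) H)); rewrite le_eqVlt; apply/orP; left; apply/eqP.
by field; rewrite gt_eqF.
Qed.

End Calculus.

(** * Two-sided deviations of multinomial counts *)

Section FiniteDKW.
Context {R : realType} (N n : nat) (eps : R).
Hypotheses (n0 : (0 < n)%N) (eps0 : 0 < eps).
Implicit Types (g : {ffun 'I_n -> 'I_N.+1}) (p : 'I_N.+1 -> R).

Lemma crossing_bound p : (forall i, 0 <= p i) -> \sum_i p i = 1 ->
  \sum_(g : {ffun 'I_n -> 'I_N.+1} | [exists j, crossing p eps j g])
     \prod_r p (g r)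
  <= expR (- (2 * n%:R * eps ^+ 2)).
Proof.
move=> p0 p1; have [c c0 Hc] := tilt_exists eps0.
(* Chosen so that [(1 + c) ^+ n / K] is exactly the claimed bound. *)
pose K := expR (n%:R * (2 * eps ^+ 2 + ln (1 + c))).
have c1 : 0 < 1 + c by rewrite ltr_pwDl // ltW.
have HK (x : R) (a : nat) : 0 <= x <= 1 -> n%:R * (x + eps) <= a%:R ->
    K * x ^+ a <= (x + c) ^+ a.
  move=> /andP[x0 _] xa; have a0 : (0 < a)%N.
    rewrite -(ltr_nat R); apply: lt_le_trans xa.
    by rewrite mulr_gt0 ?ltr0n // ltr_wpDl.
  (* When [x = 0] the left side vanishes, because [a >= n eps > 0]. *)
  move: x0; rewrite le_eqVlt => /predU1P[<-|x0].
    by rewrite expr0n gtn_eqF //= mulr0 add0r exprn_ge0 // ltW.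
  have xc : 0 < 1 + c / x by rewrite ltr_pwDl // divr_ge0 // ltW.
  have -> : x + c = x * (1 + c / x) by field; rewrite gt_eqF.
  rewrite exprMn mulrC ler_pM2l ?exprn_gt0 // -[X in _ <= X ^+ a]lnK //.
  rewrite -expRM_natl ler_expR.
  apply: (@le_trans _ _ (n%:R * ((x + eps) * ln (1 + c / x)))).
    by rewrite ler_pM2l ?ltr0n ?Hc.
  by rewrite mulrA ler_wpM2r // ln_ge0 // lerDl divr_ge0 // ltW.
have := crossing_sum p0 p1 (ltW c0) (expR_ge0 _) HK.
rewrite -ler_pdivlMl ?expR_gt0 // => /le_trans; apply.
rewrite -[X in _ * X ^+ n]lnK // -expRM_natl -expRN -expRD ler_expR le_eqVlt.
by apply/orP; left; apply/eqP; ring.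
Qed.

Lemma two_sided_bound p : (forall i, 0 <= p i) -> \sum_i p i = 1 ->
  \sum_(g : {ffun 'I_n -> 'I_N.+1} |
      [exists j, n%:R * eps <= `|(rank j g)%:R - n%:R * mass p j|])
     \prod_r p (g r)
  <= 2 * expR (- (2 * n%:R * eps ^+ 2)).
Proof.
move=> p0 p1.
pose p' i := p (rev_ord i).
pose revf g := [ffun r => rev_ord (g r)].
have revfK : involutive revf.
  by move=> g; apply/ffunP => r; rewrite !ffunE rev_ordK.
have lower g j : (rank j g)%:R - n%:R * mass p j <= - (n%:R * eps) ->
    [exists l, crossing p' eps l (revf g)].
  (* At the last cell the count is [n] and the mass is [1], so no deviation occurs there. *)
  move=> H; have jN : (j < N)%N.
    rewrite ltnNge; apply/negP => Nj.
    have all i : ((i : 'I_N.+1) <= j)%N by rewrite (leq_trans _ Nj) // -ltnS.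
    move: H; have -> : rank j g = n.
      by rewrite -[RHS]card_ord; apply: eq_card => r; rewrite !inE all.
    have -> : mass p j = 1 by rewrite -p1; apply: eq_bigl => i; rewrite all.
    by rewrite mulr1 subrr leNgt oppr_lt0 mulr_gt0 ?ltr0n.
  (* The reversal maps the cells up to [N - j - 1] onto the cells beyond [j], so a deficit up to [j]
     becomes an excess for the reversed sample. *)
  have jE (i : 'I_N.+1) : (i <= (inord (N - j).-1 : 'I_N.+1))%N = ~~ (rev_ord i <= j)%N.
    rewrite inordK /= ?subSS; last by lia.
    by have := ltn_ord i; lia.
  apply/existsP; exists (inord (N - j).-1); rewrite /crossing.
  have -> : mass p' (inord (N - j).-1) = 1 - mass p j.
    rewrite /mass -p1 [in RHS](bigID (fun i : 'I_N.+1 => (i <= j)%N)) /=.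
    rewrite addrAC subrr add0r (reindex_inj rev_ord_inj); apply: eq_big => i.
      by rewrite jE rev_ordK.
    by move=> _; rewrite /p' rev_ordK.
  have -> : rank (inord (N - j).-1) (revf g) = (n - rank j g)%N.
    have := cardC [pred r | (g r <= j)%N]; rewrite card_ord -/(rank j g) => nE.
    rewrite -[X in _ = (X - _)%N]nE addKn; apply: eq_card => r.
    by rewrite !inE ffunE jE rev_ordK.
  have rn : (rank j g <= n)%N by rewrite -[leqRHS]card_ord max_card.
  by rewrite natrB //; lra.
apply: (@le_trans _ _ (\sum_(g | [exists j, crossing p eps j g]) \prod_r p (g r) +
   \sum_(g | [exists j, crossing p' eps j g]) \prod_r p' (g r))); last first.
  rewrite mulr_natl mulr2n lerD //; apply: crossing_bound => //.
    by move=> i; exact: p0.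
  by rewrite -p1 [RHS](reindex_inj rev_ord_inj).
(* Reversing the summation variable gives both events the same weights, so the union bound can be
   checked term by term. *)
rewrite [X in _ + X](reindex_inj (can_inj revfK)) /=.
have E g : \prod_r p' (revf g r) = \prod_r p (g r).
  by apply: eq_bigr => r _; rewrite /p' ffunE rev_ordK.
under [X in _ + X]eq_bigr do rewrite E.
rewrite big_mkcond [X in _ <= X + _]big_mkcond [X in _ <= _ + X]big_mkcond.
rewrite -big_split /=; apply: ler_sum => g _.
have P0 : 0 <= \prod_r p (g r) by exact: prodr_ge0.
case: ifPn => [/existsP[j]|_]; last by rewrite addr_ge0 //; case: ifP.
rewrite ler_normr => /orP[] H.
  have -> : [exists j, crossing p eps j g].
    by apply/existsP; exists j; rewrite /crossing; lra.
  by rewrite lerDl; case: ifP.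
rewrite (lower g j) ?lerDr; first by case: ifP.
by lra.
Qed.

End FiniteDKW.

(** * Bernstein polynomials and one-sided calculus on [0, 1] *)

Section Bernstein.
Context {R : realType}.
Implicit Types (a b : nat -> R) (x M : R) (N k : nat).

(** The coefficients form an arbitrary sequence, so that [fdiff] can be iterated on them and the
    degree can drop while the grid stays fixed. *)
Definition bern N a x : R :=
  \sum_(j < N.+1) a j * 'C(N, j)%:R * x ^+ j * (1 - x) ^+ (N - j).

Definition fdiff a : nat -> R := fun j => a j.+1 - a j.

Lemma bern0 a x : bern 0 a x = a 0%N.
Proof. by rewrite /bern big_ord_recl big_ord0 /= bin0 !mulr1 addr0. Qed.

(** De Casteljau's recursion, from Pascal's rule: condition on one Bernoulli trial. *)
Lemma bernS N a x :
  bern N.+1 a x = (1 - x) * bern N a x + x * bern N (fun j => a j.+1) x.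
Proof.
rewrite /bern big_ord_recl [X in (1 - x) * X]big_ord_recl /=.
under eq_bigr => i _.
  rewrite /bump /= add1n binS natrD mulrDr !mulrDl subSS.
  over.
rewrite big_split /= addrA mulrDr !mulr_sumr; congr (_ + _ + _).
- by rewrite !subn0 !bin0 exprS; ring.
- rewrite big_ord_recr /= bin_small // mulr0 !mul0r addr0.
  apply: eq_bigr => i _; rewrite /bump /= add1n.
  have -> : (N - i = (N - i.+1).+1)%N by have := ltn_ord i; lia.
  by rewrite [(1 - x) ^+ _.+1]exprS; ring.
- by apply: eq_bigr => i _; rewrite exprS; ring.
Qed.

Lemma bernD N a b x : bern N (fun j => a j + b j) x = bern N a x + bern N b x.
Proof. by rewrite /bern -big_split /=; apply: eq_bigr => j _; rewrite !mulrDl. Qed.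

Lemma bernZ N c a x : bern N (fun j => c * a j) x = c * bern N a x.
Proof. by rewrite /bern mulr_sumr; apply: eq_bigr => j _; rewrite !mulrA. Qed.

Lemma bernB N a b x : bern N (fun j => a j - b j) x = bern N a x - bern N b x.
Proof.
rewrite -[bern N b x]mul1r -mulNr -bernZ -bernD; congr bern.
by apply/funext => j; rewrite mulN1r.
Qed.

Lemma bern_le N a x M : 0 <= x <= 1 -> (forall j, (j <= N)%N -> `|a j| <= M) ->
  `|bern N a x| <= M.
Proof.
move=> /andP[x0 x1]; elim: N a => [|N IH] a aM; first by rewrite bern0 aM.
rewrite bernS (le_trans (ler_normD _ _)) // !normrM (ger0_norm x0).
rewrite ger0_norm ?subr_ge0 //.
have -> : M = (1 - x) * M + x * M by ring.
apply: lerD; apply: ler_wpM2l => //; rewrite ?subr_ge0 //; apply: IH => j jN.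
  by rewrite aM // leqW.
exact: aM.
Qed.

Lemma is_derive_bern N a x :
  is_derive x 1 (bern N.+1 a) (N.+1%:R * bern N (fdiff a) x).
Proof.
elim: N a => [|N IH] a.
  have -> : bern 1 a = fun y => (1 - y) * a 0%N + y * a 1%N.
    by apply/funext => y; rewrite bernS !bern0.
  by apply: is_derive_eq; rewrite bern0 /fdiff /GRing.scale /=; ring.
have -> : bern N.+2 a =
    fun y => (1 - y) * bern N.+1 a y + y * bern N.+1 (fun j => a j.+1) y.
  by apply/funext => y; rewrite bernS.
have := IH a; have := IH (fun j => a j.+1) => d1 d2.
(* Differentiating the weights [1 - y] and [y] yields one copy of [bern N.+1 (fdiff a)]; the
   induction hypotheses yield [N.+1] further copies, recombined by [bernS]. *)
apply: is_derive_eq; rewrite /GRing.scale /=.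
have H := bernS N (fdiff a) x.
have E : bern N.+1 (fdiff a) x = bern N.+1 (fun j => a j.+1) x - bern N.+1 a x.
  by rewrite -bernB.
rewrite E -[N.+2]addn1 natrD; rewrite E in H.
have -> : fdiff (fun j => a j.+1) = fun j => fdiff a j.+1 by [].
have -> : (N.+1%:R + 1%:R) * (bern N.+1 (fun j => a j.+1) x - bern N.+1 a x) =
  N.+1%:R * ((1 - x) * bern N (fdiff a) x + x * bern N (fun j => fdiff a j.+1) x) +
  (bern N.+1 (fun j => a j.+1) x - bern N.+1 a x) by rewrite -H; ring.
by ring.
Qed.

Lemma derive1n_bern N k a : (k <= N)%N ->
  derive1n k (bern N a) = fun x => (N ^_ k)%:R * bern (N - k) (iter k fdiff a) x.
Proof.
elim: k => [|k IH] kN.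
  by rewrite derive1n0 subn0; apply/funext => x; rewrite ffactn0 mul1r.
rewrite derive1nS IH ?(ltnW kN) //; apply/funext => x.
have -> : (N - k = (N - k.+1).+1)%N by lia.
have d := is_derive_bern (N - k.+1) (iter k fdiff a) x.
rewrite derive1E derive_val /GRing.scale /=.
by rewrite ffactnSr natrM mulrA; congr (_ * _%:R * _); lia.
Qed.

(** Each difference at most doubles the bound; this is the source of the factor [2 ^+ k] in
    [threshold]. *)
Lemma fdiffn_le N k a M : (forall j, (j <= N)%N -> `|a j| <= M) ->
  forall j, (j + k <= N)%N -> `|iter k fdiff a j| <= 2 ^+ k * M.
Proof.
move=> aM; elim: k => [|k IH] j jk; first by rewrite mul1r aM // -[j]addn0.
rewrite iterS /fdiff (le_trans (ler_normB _ _)) // exprS -mulrA mulr_natl mulr2n.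
by rewrite lerD // IH; lia.
Qed.

Lemma fdiffnB k a b j :
  iter k fdiff (fun i => a i - b i) j = iter k fdiff a j - iter k fdiff b j.
Proof. by elim: k j => [|k IH] j //=; rewrite /fdiff !IH; ring. Qed.

Lemma bernsteinE m (f : R -> R) :
  bernstein m f = bern m (fun j => f (j%:R / m%:R)).
Proof. by []. Qed.

End Bernstein.

Section OneSided.
Context {R : realType}.
Implicit Types (f : R -> R) (x : R).

Lemma continuous01P f : {within `[0, 1], continuous f} <->
  forall x : R, 0 <= x <= 1 -> forall e : R, 0 < e ->
    \forall y \near x, 0 <= y <= 1 -> `|f x - f y| <= e.
Proof.
split=> [/subspace_continuousP cf x x01 e e0|cf].
  have /cf/cvgrPdist_le/(_ _ e0) : `[0, 1]%classic x by rewrite /= in_itv.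
  by rewrite near_withinE; apply: filterS => y; rewrite /= in_itv.
apply/subspace_continuousP => x; rewrite /= in_itv /= => x01.
apply/cvgrPdist_le => e e0; rewrite near_withinE.
by apply: filterS (cf x x01 e e0) => y; rewrite /= in_itv.
Qed.

Lemma derivable01_continuous f :
  (forall x, x \in `[0, 1] -> derivable01 f x) -> {within `[0, 1], continuous f}.
Proof.
move=> df; apply/continuous01P => x x01 e e0.
have /df : x \in `[0, 1] by rewrite in_itv.
rewrite /derivable01 => /cvg_ex[/= l fl].
have /cvgrPdist_le/(_ _ ltr01) := fl.
rewrite near_withinE => H.
have {}H : \forall y \near x, y != x -> 0 <= y <= 1 -> `|l - quotient01 f x y| <= 1.
  move: H; rewrite near_withinE; apply: filterS => y h yx y01.
  by apply: h => //=; rewrite in_itv.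
(* Near [x] the quotient is bounded by [|l| + 1], so this radius keeps the increment of [f] below
   [e]. *)
have e'0 : 0 < e / (`|l| + 1) by rewrite divr_gt0 // ltr_wpDl.
have := nbhsx_ballx x _ e'0; rewrite -[nbhs x _]/(\near x, _).
apply: filterS2 H => y H yx y01.
have [->|yn] := eqVneq y x; first by rewrite subrr normr0 ltW.
have {}H := H yn y01.
have -> : f x - f y = - (quotient01 f x y * (y - x)).
  by rewrite /quotient01 divfK ?subr_eq0 // opprB.
rewrite normrN normrM.
have q : `|quotient01 f x y| <= `|l| + 1.
  rewrite -(subrK l (quotient01 f x y)) addrC (le_trans (ler_normD _ _)) // lerD2l.
  by rewrite distrC.
apply: (le_trans (ler_pM (normr_ge0 _) (normr_ge0 _) q (ltW _))).
  by move: yx; rewrite /ball /= distrC; apply.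
by rewrite mulrC divfK // gt_eqF // ltr_wpDl.
Qed.

(** An interior point has a neighbourhood inside [0, 1], where the restriction of the difference
    quotients is invisible. *)
Lemma is_derive01 f x : 0 < x < 1 -> derivable01 f x ->
  is_derive x 1 f (derive01 f x).
Proof.
move=> /andP[x0 x1] df.
have H e : 0 < e -> \forall y \near x, y != x ->
    `|derive01 f x - quotient01 f x y| <= e.
  move=> e0; have /cvgrPdist_le/(_ _ e0) : quotient01 f x y
      @[y --> within `[0, 1] x^'] --> derive01 f x by exact: df.
  rewrite !near_withinE => H.
  have x01 : \forall y \near x, 0 <= y <= 1.
    near=> y; apply/andP; split; apply: ltW; near: y; [exact: lt_nbhsr|exact: lt_nbhsl].
  by apply: filterS2 x01 H => y y01 H yx; apply: H => //=; rewrite in_itv.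
have g : h^-1 *: ((f \o shift x) (h *: 1) - f x) @[h --> (0 : R)^'] --> derive01 f x.
  apply/cvgrPdist_le => e e0; rewrite near_withinE.
  have := H e e0; rewrite (near_shift 0) subr0.
  apply: filterS => h /= K h0.
  have : h + x != x by rewrite -subr_eq0 addrK.
  move=> /K; rewrite /quotient01 addrK /GRing.scale /= mulr1.
  by rewrite [_^-1 * _]mulrC.
by split; [apply: cvgP g|apply: cvg_lim g].
Unshelve. all: by end_near. Qed.

End OneSided.

Section AffineFTC.
Context {R : realType}.
Implicit Types (f : R -> R) (x z M : R).

Let affine01 z M (v : R) : 0 < M -> 0 <= z -> z + 1 <= M -> 0 <= v <= 1 ->
  0 <= (z + v) / M <= 1.
Proof.
move=> M0 z0 zM /andP[v0 v1]; rewrite divr_ge0 ?addr_ge0 ?(ltW M0) //=.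
by rewrite ler_pdivrMr // mul1r (le_trans _ zM) // lerD2l.
Qed.

Lemma continuous01_affine f z M : 0 < M -> 0 <= z -> z + 1 <= M ->
  {within `[0, 1], continuous f} ->
  {within `[0, 1], continuous (fun v => f ((z + v) / M))}.
Proof.
move=> M0 z0 zM /continuous01P cf; apply/continuous01P => v v01 e e0.
have av : (z + w) / M @[w --> v] --> (z + v) / M.
  by apply: cvgM; [apply: cvgD; [exact: cvg_cst|exact: cvg_id]|exact: cvg_cst].
have H : \forall w \near v, 0 <= (z + w) / M <= 1 ->
    `|f ((z + v) / M) - f ((z + w) / M)| <= e.
  exact: (av _ (cf _ (affine01 M0 z0 zM v01) e e0)).
by apply: filterS H => w H w01; apply: H; exact: affine01.
Qed.

(** Averaging a derivative over one uniform variable gives a forward difference of step [1 / M]: the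
    antiderivative of the integrand is [G], and continuity of [G] suffices at the endpoints. *)
Lemma integral_derive01_affine f z M : 0 < M -> 0 <= z -> z + 1 <= M ->
  (forall x, x \in `[0, 1] -> derivable01 f x) ->
  {within `[0, 1], continuous (derive01 f)} ->
  (\int[lebesgue_measure]_(v in `[0%R, 1%R]) (derive01 f ((z + v) / M))%:E =
   (M * (f ((z + 1) / M) - f (z / M)))%:E)%E.
Proof.
move=> M0 z0 zM df cf; pose G v := M * f ((z + v) / M).
have cG : {within `[0, 1], continuous G}.
  have cf0 := continuous01_affine M0 z0 zM (derivable01_continuous df).
  move=> v; apply: cvgMr; exact: cf0.
have dG (v : R) : v \in `]0, 1[ -> is_derive v 1 G (derive01 f ((z + v) / M)).
  rewrite in_itv /= => /andP[v0 v1].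
  have y01 : 0 < (z + v) / M < 1.
    rewrite divr_gt0 ?ltr_wpDl //= ltr_pdivrMr // mul1r.
    by rewrite (lt_le_trans _ zM) // ltrD2l.
  have dy : is_derive ((z + v) / M) 1 f (derive01 f ((z + v) / M)).
    by apply: is_derive01 => //; apply: df; rewrite in_itv /= !ltW //; case/andP: y01.
  have da : is_derive v 1 (fun w => (z + w) / M) M^-1.
    by apply: is_derive_eq; rewrite /GRing.scale /=; ring.
  have dc : is_derive v 1 (fun w => f ((z + w) / M)) (derive01 f ((z + v) / M) * M^-1).
    exact: (@is_derive1_comp R f (fun w => (z + w) / M) v).
  by apply: is_derive_eq; rewrite /GRing.scale /=; field; rewrite gt_eqF.
rewrite (@continuous_FTC2 R _ G 0 1) //.
- by rewrite /G addr0 -EFinB mulrBr.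
- exact: continuous01_affine.
- have /continuous_within_itvP[//| _ G0 G1] := cG.
  by split=> // v /dG H; exact: ex_derive.
- by move=> v /dG H; rewrite derive1E derive_val.
Qed.

End AffineFTC.

(** * The Bernstein-Kantorovich operator *)

Section BoundedIntegrals.
Context {R : realType}.
Local Open Scope ereal_scope.

Lemma probability_bounded_integrable d (T : measurableType d)
    (P : probability T R) (f : T -> R) (M : R) :
  measurable_fun setT f -> (forall x, `|f x| <= M)%R ->
  P.-integrable setT (fun x => (f x)%:E).
Proof.
move=> mf fM; apply: measurable_bounded_integrable => //.
  by apply: le_lt_trans (ltry 1); exact: probability_le1.
by exists M; split; [exact: num_real|move=> y My x _; apply: le_trans (fM x) (ltW My)].
Qed.

Section IidStep.
Context d (T : measurableType d) (P : probability T R) (n : nat).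
Variables (f : n.+1.-tuple T -> R) (M : R).
Hypotheses (mf : measurable_fun setT f) (fM : (forall t, `|f t| <= M)%R).

Let integrable_tcons :
  (P \x iid_prob P n).-integrable setT (fun w => (f (tcons w))%:E).
Proof.
apply: (@probability_bounded_integrable _ _ (P \x iid_prob P n)%E
  (f \o @tcons _ T n) M) => // [|w]; last exact: fM.
by apply: measurableT_comp => //; exact: measurable_tcons.
Qed.

Lemma integral_iid_probS : \int[iid_prob P n.+1]_t (f t)%:E =
  \int[P]_v \int[iid_prob P n]_t (f (tcons (v, t)))%:E.
Proof.
rewrite /= integral_distribution //=; last exact/measurable_EFinP.
by rewrite -(integral12_prod_meas1 integrable_tcons).
Qed.

Lemma measurable_integral_iid_prob : measurable_fun setT
  (fun v => \int[iid_prob P n]_t (f (tcons (v, t)))%:E).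
Proof. exact: (measurable_fubini_F integrable_tcons). Qed.

End IidStep.

Lemma integral_uniform01 (f : measurableTypeR R -> \bar R) : measurable_fun setT f ->
  \int[uniform_prob (@ltr01 R)]_x f x = \int[lebesgue_measure]_(x in `[0%R, 1%R]) f x.
Proof.
move=> mf; rewrite integralE [RHS]integralE.
rewrite !integral_uniform //; try exact: measurable_funepos; try exact: measurable_funeneg.
by rewrite subr0 invr1 !mul1e.
Qed.

Lemma integral_binomial_EFin n (x : R) (f : nat -> R) : (0 <= x <= 1)%R ->
  \int[binomial_prob n x]_j (f j)%:E =
  (\sum_(j < n.+1) f j * 'C(n, j)%:R * x ^+ j * (1 - x) ^+ (n - j))%:E.
Proof.
move=> /andP[x0 x1]; rewrite integralE.
rewrite !(@integral_binomial _ n x x0 x1) //.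
under eq_bigr do rewrite funeposE -EFin_max -EFinM.
under [X in _ - X]eq_bigr do rewrite funenegE -EFinN -EFin_max -EFinM.
rewrite !sumEFin -EFinB -sumrB; congr EFin; apply: eq_bigr => j _ /=.
rewrite -mulrBr; have -> : (Num.max (f j) 0 - Num.max (- f j) 0 = f j)%R.
  by rewrite !maxEle; case: (leP (f j) 0%R); case: (leP (- f j)%R 0%R) => /=; lra.
by rewrite /unstable.onem -mulr_natr; ring.
Qed.

End BoundedIntegrals.

Section FiniteDifferences.
Context {R : realType}.

Lemma fdiffn_shift k (a : nat -> R) i j :
  iter k fdiff (fun l => a (i + l)%N) j = iter k fdiff a (i + j)%N.
Proof. by elim: k j => [|k IH] j //=; rewrite /fdiff !IH addnS. Qed.

Lemma fdiffnZ k (c : R) (a : nat -> R) j :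
  iter k fdiff (fun l => c * a l) j = c * iter k fdiff a j.
Proof. by elim: k j => [|k IH] j //=; rewrite /fdiff !IH mulrBr. Qed.

(** Linearity of the integral. Integrability is part of the conclusion because the induction
    subtracts two integrals. *)
Lemma integral_fdiffn d (T : measurableType d) (mu : {measure set T -> \bar R})
    (D : set T) (h : T -> nat -> R) (c : nat -> R) N k j : measurable D ->
  (forall i, (i <= N)%N -> mu.-integrable D (fun v => (h v i)%:E) /\
    (\int[mu]_(v in D) (h v i)%:E = (c i)%:E)%E) ->
  (j + k <= N)%N ->
  mu.-integrable D (fun v => (iter k fdiff (h v) j)%:E) /\
  (\int[mu]_(v in D) (iter k fdiff (h v) j)%:E = (iter k fdiff c j)%:E)%E.
Proof.
move=> mD H; elim: k j => [|k IH] j jk /=; first by apply: H; rewrite -[j]addn0.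
have [|I1 E1] := IH j.+1; first by rewrite addSnnS.
have [|I0 E0] := IH j; first by rewrite (leq_trans _ jk) // leq_add2l.
have I : mu.-integrable D ((fun v => (iter k fdiff (h v) j.+1)%:E) \-
    (fun v => (iter k fdiff (h v) j)%:E))%E by exact: integrableB.
by split => //; rewrite /fdiff EFinB -E1 -E0 -integralB.
Qed.

End FiniteDifferences.

Section KantorovichDifferences.
Context {R : realType}.
Implicit Types (f g : R -> R).

Lemma C01S k f : C01 k.+1 f ->
  (forall x, x \in `[0, 1] -> derivable01 f x) /\ C01 k (derive01 f).
Proof.
move=> [df cf]; split; first by move=> x; apply: (df 0%N).
split=> [i x ik x01|]; last by move: cf; rewrite /derive01n iterSr.
by have := df i.+1 x ik x01; rewrite /derive01n iterSr.
Qed.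

Lemma C01_continuous k f : C01 k f -> {within `[0, 1], continuous f}.
Proof.
case: k => [[]//|k] /C01S[df _]; exact: derivable01_continuous.
Qed.

Lemma measurable_patch01 g : {within `[0, 1], continuous g} ->
  measurable_fun setT (g \_ `[0, 1]).
Proof.
move=> cg; apply/measurable_restrict => //; rewrite setTI.
exact: subspace_continuous_measurable_fun.
Qed.

Lemma bounded_patch01 g : {within `[0, 1], continuous g} ->
  exists M, forall x, `|(g \_ `[0, 1]) x| <= M.
Proof.
move=> cg.
have cng : {within `[0, 1], continuous (fun x => `|g x|)}.
  by move=> x; apply: cvg_norm; exact: cg.
have [x _ Hx] := EVT_max ler01 cng.
exists `|g x| => y; rewrite patchE; case: ifPn => [|_]; last by rewrite normr0.
by rewrite inE => y01; apply: Hx.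
Qed.

Lemma measurable_affine_sum k (z m : R) : measurable_fun setT
  (fun t : k.-tuple (measurableTypeR R) => (z + \sum_(i < k) (tnth t i : R)) / m).
Proof.
apply: measurable_funM => //; apply: measurable_funD => //.
by apply: measurable_sum => i; exact: measurable_tnth.
Qed.

(** The fundamental theorem of calculus, iterated: for a fixed first variable [v] the induction
    hypothesis for [derive01 f] at [z + v] leaves a [k]-th difference, and integrating over [v] adds
    one more difference and one more factor [m]. *)
Lemma integral_iid_derive01n k (m : R) f z : 0 < m -> C01 k f ->
  0 <= z -> z + k%:R <= m ->
  (\int[iid_prob (uniform_prob (@ltr01 R)) k]_t
     ((derive01n k f \_ `[0%R, 1%R])
        ((z + \sum_(i < k) (tnth t i : R)) / m))%:E =
   (m ^+ k * iter k fdiff (fun j => f ((z + j%:R) / m)) 0%N)%:E)%E.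
Proof.
move=> m0; elim: k f z => [|k IH] f z Cf z0 zm.
  (* The law of the empty tuple is a Dirac mass, and [z / m] lies in [0, 1], where the extension by
     0 changes nothing. *)
  rewrite /= integral_dirac //.
    rewrite diracT mul1e mul1r big_ord0 patchE mem_set //= in_itv /=.
    rewrite addr0 divr_ge0 ?(ltW m0) //= ler_pdivrMr // mul1r.
    by move: zm; rewrite addr0.
  apply/measurable_EFinP.
  apply: (measurableT_comp (measurable_patch01 (C01_continuous Cf))).
  exact: measurable_affine_sum.
have [df Cdf] := C01S Cf.
have dE : derive01n k.+1 f = derive01n k (derive01 f) by rewrite /derive01n iterSr.
have cg : {within `[0, 1], continuous (derive01n k.+1 f)} by case: Cf.
have [M HM] := bounded_patch01 cg.
have mk : measurable_fun setT (fun t : k.+1.-tuple (measurableTypeR R) =>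
    (derive01n k.+1 f \_ `[0%R, 1%R]) ((z + \sum_(i < k.+1) (tnth t i : R)) / m)).
  apply: (measurableT_comp (measurable_patch01 cg)).
  exact: measurable_affine_sum.
rewrite (integral_iid_probS (uniform_prob (@ltr01 R)) mk (fun t => HM _)).
rewrite integral_uniform01; last first.
  exact: (measurable_integral_iid_prob (uniform_prob (@ltr01 R)) mk (fun t => HM _)).
rewrite (eq_integral (fun v : measurableTypeR R =>
  (m ^+ k * iter k fdiff (fun j => derive01 f ((z + j%:R + v) / m)) 0%N)%:E)); last first.
  move=> v; rewrite inE /= in_itv /= => /andP[v0 v1].
  under eq_integral => t _.
    rewrite big_ord_recl tnth0 addrA [derive01 _]dE /=.
    under eq_bigr => i _ do rewrite tnthS.
    over.
  rewrite IH ?addr_ge0 //; last first.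
    by rewrite (le_trans _ zm) // -addrA lerD2l -natr1 addrC lerD2l.
  by congr (_ * iter k fdiff _ 0%N)%:E; apply/funext => j; rewrite addrAC.
pose a j := f ((z + j%:R) / m).
have [|i ik||I E] := @integral_fdiffn R _ _ (@lebesgue_measure R) `[0, 1]%classic
    (fun v j => derive01 f ((z + j%:R + v) / m)) (fun j => m * fdiff a j) k k 0.
- exact: measurable_itv.
- have zi0 : 0 <= z + i%:R by rewrite addr_ge0.
  have zi1 : z + i%:R + 1 <= m.
    by rewrite (le_trans _ zm) // -addrA lerD2l natr1 ler_nat.
  have cdf := C01_continuous Cdf.
  split.
    apply: continuous_compact_integrable; first exact: segment_compact.
    exact: continuous01_affine.
  rewrite integral_derive01_affine //; congr (_ * _)%:E.
  by rewrite /fdiff /a -addrA natr1.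
- by [].
under eq_integral do rewrite EFinM.
rewrite integralZl //= E -EFinM fdiffnZ -iterS iterSr; congr EFin.
by rewrite exprSr mulrA.
Qed.

End KantorovichDifferences.

Section KantorovichFormula.
Context {R : realType}.

(** By Fubini, fix the binomial value [j] and integrate the uniform variables first: this gives
    [m ^ k] times the [k]-th difference at [j], whose binomial average is a Bernstein sum of degree
    [m - k]. *)
Lemma kantorovichE k m (f : R -> R) (x : R) : (k < m)%N -> C01 k f ->
  0 <= x <= 1 ->
  kantorovich m k (derive01n k f) x =
  m%:R ^+ k * bern (m - k) (iter k fdiff (fun j => f (j%:R / m%:R))) x.
Proof.
move=> km Cf x01.
have m0 : 0 < m%:R :> R by rewrite ltr0n (leq_ltn_trans _ km).
have cg : {within `[0, 1], continuous (derive01n k f)} by case: Cf.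
have [M HM] := bounded_patch01 cg.
have mw : measurable_fun setT (fun w : (nat * k.-tuple (measurableTypeR R))%type =>
    (derive01n k f \_ `[0%R, 1%R]) ((w.1%:R + \sum_(i < k) (tnth w.2 i : R)) / m%:R)).
  apply: (measurableT_comp (measurable_patch01 cg)).
  apply: measurable_funM => //; apply: measurable_funD.
    apply: (measurableT_comp (f := fun n : nat => n%:R : R)) => //.
  apply: measurable_sum => i.
  by apply: (measurableT_comp (f := fun t : k.-tuple (measurableTypeR R) => tnth t i)) => //;
    exact: measurable_tnth.
have Iw := @probability_bounded_integrable R _ _ (kantorovich_prob m k x) _ M mw
  (fun w => HM _).
rewrite /kantorovich unlock.
have <- := integral12_prod_meas1 Iw.
pose inner (j : nat) := (\int[iid_prob (uniform_prob (@ltr01 R)) k]_t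
  ((derive01n k f \_ `[0%R, 1%R]) ((j%:R + \sum_(i < k) (tnth t i : R)) / m%:R))%:E)%E.
transitivity (fine (\int[binomial_prob (m - k) x]_j (fine (inner j))%:E)).
  congr fine; apply: eq_integral => j _; rewrite fineK //.
  apply: integrable_fin_num => //.
  apply: (@probability_bounded_integrable R _ _ (iid_prob (uniform_prob (@ltr01 R)) k)
    (fun t => (derive01n k f \_ `[0%R, 1%R])
       ((j%:R + \sum_(i < k) (tnth t i : R)) / m%:R)) M) => [|t]; last exact: HM.
  apply: (measurableT_comp (measurable_patch01 cg)).
  exact: measurable_affine_sum.
rewrite integral_binomial_EFin //= mulr_sumr; apply: eq_bigr => j _.
(* This keeps every argument of the inner integral in [0, 1]. *)
have jm : (j + k <= m)%N by have := ltn_ord j; lia.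
rewrite /inner integral_iid_derive01n // -?natrD ?ler_nat //=.
rewrite !mulrA; congr (_ * _ * _ * _ * _).
have -> : nat_of_ord j = (j + 0)%N by rewrite addn0.
rewrite -fdiffn_shift addn0.
by congr (iter k fdiff _ 0%N); apply/funext => i; rewrite natrD.
Qed.

End KantorovichFormula.

(** * Empirical distribution functions on the grid *)

Section Fibers.
Context d (T : measurableType d) {R : realType} (mu : {measure set T -> \bar R}).

(** An event about a finite-valued map is a finite disjoint union of fibres; this turns
    probabilities into the sums bounded above. *)
Lemma measure_fibers (I : finType) (c : T -> I) (Q : pred I) :
  (forall i, measurable (c @^-1` [set i])) ->
  mu [set w | Q (c w)] = (\sum_(i | Q i) mu (c @^-1` [set i]))%E.
Proof.
move=> mc.
rewrite (_ : [set w | _] = \bigcup_(i in [set` [seq i <- index_enum I | Q i]])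
    c @^-1` [set i]); last first.
  apply/seteqP; split=> [w Qw|w [i Qi /= cw]] /=.
    by exists (c w) => //=; rewrite mem_filter mem_index_enum andbT.
  by move: Qi; rewrite /= mem_filter cw => /andP[].
rewrite measure_fin_bigcup //.
- by rewrite -fsbig_seq ?filter_uniq ?index_enum_uniq // big_filter.
- by move=> i j _ _ [w [<- <-]].
Qed.

End Fibers.

Section Cells.
Context {R : realType} (m : nat).

(* [cell v <= j] iff [v <= j / m]; the last cell collects the [v > 1]. *)
Definition cell (v : R) : 'I_m.+2 :=
  inord #|[pred j : 'I_m.+1 | j%:R / m%:R < v]|.

(** The grid points strictly below [v] form an initial segment, so at most [j] of them exist exactly
    when [j / m] is not one of them. *)
Lemma cell_le (v : R) (j : nat) : (0 < m)%N -> (j <= m)%N ->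
  (cell v <= j)%N = (v <= j%:R / m%:R).
Proof.
move=> m0 jm; rewrite /cell inordK; last first.
  by rewrite ltnS -[leqRHS]card_ord max_card.
have card_lt l : (l <= m.+1)%N -> #|[pred i : 'I_m.+1 | (i < l)%N]| = l.
  by move=> lm; rewrite -sum1_card (big_ord_narrow lm) sum_nat_const card_ord muln1.
have mR : 0 < m%:R :> R by rewrite ltr0n.
apply/idP/idP => [|vj].
  apply: contraTT; rewrite -ltNge -ltnNge => jv.
  rewrite -(card_lt j.+1) //; apply/subset_leq_card/fintype.subsetP => i; rewrite !inE ltnS => ij.
  by apply: le_lt_trans jv; rewrite ler_pM2r ?invr_gt0 // ler_nat.
rewrite -[leqRHS]card_lt ?leqW //; apply/subset_leq_card/fintype.subsetP => i; rewrite !inE => iv.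
have := lt_le_trans iv vj.
by rewrite ltr_pM2r ?invr_gt0 // ltr_nat.
Qed.

Lemma measurable_cell (i : 'I_m.+2) : (0 < m)%N -> measurable (cell @^-1` [set i]).
Proof.
move=> m0.
have mle (j : nat) : measurable [set v | (cell v <= j)%N].
  have [jm|mj] := leqP j m.
    rewrite (_ : mkset _ = `]-oo, j%:R / m%:R]%classic).
      exact: measurable_itv.
    by apply/seteqP; split=> v /=; rewrite in_itv /= cell_le.
  rewrite (_ : mkset _ = setT) //; apply/seteqP; split=> v //= _.
  by rewrite (leq_trans _ mj) // -ltnS.
have [i0|i0] := posnP i.
  rewrite (_ : _ @^-1` _ = [set v | (cell v <= 0)%N]) //.
  apply/seteqP; split=> v /=; first by move=> ->; rewrite i0.
  by rewrite leqn0 => /eqP E; apply/val_inj; rewrite /= E i0.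
rewrite (_ : _ @^-1` _ = [set v | (cell v <= i)%N] `\` [set v | (cell v <= i.-1)%N]).
  exact: measurableD.
apply/seteqP; split=> v /=; first by move=> ->; split => //; lia.
by move=> [] h /negP h'; apply/val_inj/eqP; rewrite /= eqn_leq h /=; lia.
Qed.

End Cells.

Lemma bern_deviation {R : realType} k m (f : R -> R) (a : nat -> R) (e B x : R) :
  (k < m)%N -> C01 k f -> 0 <= x <= 1 ->
  (forall j, (j <= m)%N -> `|a j - f (j%:R / m%:R)| <= e) ->
  `|(m ^_ k)%:R / m%:R ^+ k * kantorovich m k (derive01n k f) x - derive01n k f x| <= B ->
  `|derive1n k (bern m a) x - derive01n k f x| <= 2 ^+ k * (m ^_ k)%:R * e + B.
Proof.
move=> km Cf x01 ae HB; rewrite derive1n_bern ?(ltnW km) //.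
pose b j := f (j%:R / m%:R).
have m0 : m%:R ^+ k != 0 :> R.
  by rewrite expf_neq0 // pnatr_eq0 -lt0n (leq_ltn_trans _ km).
(* Subtracting and adding the grid values [b] separates the estimation error from the bias, which
   [kantorovichE] identifies. *)
have -> : (m ^_ k)%:R * bern (m - k) (iter k fdiff a) x - derive01n k f x =
    (m ^_ k)%:R * bern (m - k) (iter k fdiff (fun j => a j - b j)) x +
    ((m ^_ k)%:R / m%:R ^+ k * kantorovich m k (derive01n k f) x - derive01n k f x).
  rewrite kantorovichE // mulrA divfK // -/b.
  have -> : iter k fdiff (fun j => a j - b j) =
      fun j => iter k fdiff a j - iter k fdiff b j.
    by apply/funext => j; rewrite fdiffnB.
  by rewrite bernB; ring.
rewrite (le_trans (ler_normD _ _)) // lerD // normrM ger0_norm //.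
rewrite [2 ^+ k * _]mulrC -mulrA ler_wpM2l //; apply: bern_le => // j jmk.
by apply: (@fdiffn_le _ m) => //; lia.
Qed.

Section EmpiricalCells.
Context {d d0} {T : measurableType d} {T0 : measurableType d0} {R : realType}.
Variables (P : probability T R) (P0 : probability T0 R) (X0 : {RV P0 >-> R}).
Variables (n m : nat) (X : 'I_n -> {RV P >-> R}).
Hypotheses (hX : independent_copies X0 X) (m0 : (0 < m)%N).

Definition cell_prob (i : 'I_m.+2) : R := fine (P0 (X0 @^-1` (cell m @^-1` [set i]))).

Definition cells (w : T) : {ffun 'I_n -> 'I_m.+2} := [ffun r => cell m (X r w)].

Let measurable_cellX0 i : measurable ((cell m \o X0) @^-1` [set i]).
Proof.
rewrite comp_preimage -[X in measurable X]setTI.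
by apply: measurable_funPT => //; exact: measurable_cell.
Qed.

Lemma cell_probE i : P0 (X0 @^-1` (cell m @^-1` [set i])) = (cell_prob i)%:E.
Proof. by rewrite fineK // fin_num_measure //; exact: measurable_cellX0. Qed.

Lemma cell_prob_ge0 i : 0 <= cell_prob i.
Proof. exact: fine_ge0. Qed.

Lemma sum_cell_prob (Q : pred 'I_m.+2) :
  (\sum_(i | Q i) cell_prob i)%:E = P0 [set w | Q (cell m (X0 w))].
Proof.
rewrite (measure_fibers P0 (c := cell m \o X0)) //.
by rewrite -sumEFin; apply: eq_bigr => i _; rewrite -cell_probE.
Qed.

Lemma sum_cell_prob1 : \sum_i cell_prob i = 1.
Proof.
apply: EFin_inj; rewrite sum_cell_prob.
by rewrite (_ : mkset _ = setT) ?probability_setT //; apply/seteqP; split.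
Qed.

Lemma mass_cell_prob (F : R -> R) (j : 'I_m.+2) :
  (forall x, (F x)%:E = cdf X0 x) -> (j <= m)%N ->
  mass cell_prob j = F (j%:R / m%:R).
Proof.
move=> hF jm; apply: EFin_inj; rewrite hF sum_cell_prob.
by congr (P0 _); apply/seteqP; split=> w /=; rewrite in_itv /= cell_le.
Qed.

Lemma ecdf_cells w (j : 'I_m.+2) : (j <= m)%N ->
  ecdf X w (j%:R / m%:R) = n%:R^-1 * (rank j (cells w))%:R.
Proof.
move=> jm; rewrite /ecdf; congr (_ * _); rewrite /rank -sum1_card natr_sum.
rewrite [RHS]big_mkcond /=; apply: eq_bigr => r _.
rewrite indicE inE /= ffunE cell_le //.
have -> : (X r w \in `]-oo, j%:R / m%:R]%classic) = (X r w <= j%:R / m%:R).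
  by apply/idP/idP; rewrite inE /= in_itv.
by case: ifP.
Qed.

(** The intersection runs over the full index set to match [mutually_independent]. *)
Lemma cells_preimage g : cells @^-1` [set g] =
  \bigcap_(r in [set` [set: 'I_n]%SET]) X r @^-1` (cell m @^-1` [set g r]).
Proof.
apply/seteqP; split=> w /=.
  by move=> <- r _ /=; rewrite ffunE.
by move=> H; apply/ffunP => r; rewrite ffunE; apply: H; rewrite /= inE.
Qed.

Lemma measurable_cells g : measurable (cells @^-1` [set g]).
Proof.
rewrite cells_preimage; apply: fin_bigcap_measurable => // r _.
rewrite -[X in measurable X]setTI.
by apply: measurable_funPT => //; exact: measurable_cell.
Qed.

Lemma cells_law g : P (cells @^-1` [set g]) = (\prod_r cell_prob (g r))%:E.
Proof.
have [indep law] := hX.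
rewrite cells_preimage (indep _ (fun r => cell m @^-1` [set g r])); last first.
  by move=> r; exact: measurable_cell.
rewrite -prodEFin; apply: eq_big => [r|r _]; first by rewrite inE.
rewrite -cell_probE; apply: law; exact: measurable_cell.
Qed.

End EmpiricalCells.

(** * From grid deviations to the supremum norm *)

Theorem theorem4p1 (R : realType)
  (d d0 : measure_display) (T : measurableType d) (T0 : measurableType d0)
  (P : probability T R) (P0 : probability T0 R)
  (k n : nat) (hn : (2 <= n)%N) (alpha : R) (halpha : 0 < alpha < 1)
  (X0 : {RV P0 >-> R}) (hX0 : forall w, X0 w \in `[0, 1])
  (F : R -> R) (hF : forall x, (F x)%:E = cdf X0 x) (hFk : C01 k F)
  (X : 'I_n -> {RV P >-> R}) (hX : independent_copies X0 X)
  (m : nat) (hm : (maxn k 1 < m)%N)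
  (hbias : bias_small k n alpha F m)
  (hfirst : forall m', (maxn k 1 < m')%N -> (m' < m)%N ->
     ~ bias_small k n alpha F m') :
  (P [set w | (threshold k alpha m / Num.sqrt n%:R)%R%:E
              < supnorm01 (fun x => derive1n k (bernstein m (ecdf X w)) x
                                    - derive01n k F x)%R]
   <= alpha%:E)%E.
Proof.
have [a0 a1] := andP halpha.
have km : (k < m)%N by lia.
have m0 : (0 < m)%N by lia.
have n0 : (0 < n)%N by lia.
have nR : 0 < n%:R :> R by rewrite ltr0n.
set L := ln (2 / alpha); set t := threshold k alpha m / Num.sqrt n%:R.
have L0 : 0 < L by rewrite ln_gt0 // ltr_pdivlMr // mul1r (lt_trans a1) // ltr1n.
(* With this [e] the estimation error takes half of [t], the bias taking the other half, and
   [2 n e^2 = L] makes the tail bound equal to [alpha]. *)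
pose e := 2^-1 * Num.sqrt (2 * L) / Num.sqrt n%:R.
have e0 : 0 < e by rewrite !mulr_gt0 ?invr_gt0 ?sqrtr_gt0 ?mulr_gt0.
have eE : 2 * n%:R * e ^+ 2 = L.
  rewrite /e expr_div_n exprMn !sqr_sqrtr ?mulr_ge0 ?(ltW L0) //.
  by field; rewrite gt_eqF.
have te : 2 ^+ k * (m ^_ k)%:R * e + 2^-1 * threshold k alpha m / Num.sqrt n%:R = t.
  rewrite /t /e /threshold -/L; field.
  by rewrite gt_eqF // sqrtr_gt0.
(* The empirical distribution function at [j / m], read off the cells. Only [j <= m] occurs, so
   [inord] never takes its default value. *)
pose Y (g : {ffun 'I_n -> 'I_m.+2}) (j : nat) : R := n%:R^-1 * (rank (inord j) g)%:R.
pose bad g := (t%:E < supnorm01 (fun x => derive1n k (bern m (Y g)) x - derive01n k F x)%R)%E.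
pose p := @cell_prob _ _ _ P0 X0 m.
have inordE j : (j <= m)%N -> (inord j : 'I_m.+2) = j :> nat.
  by move=> jm; rewrite inordK; lia.
have bernY w : bernstein m (ecdf X w) = bern m (Y (cells m X w)).
  apply/funext => x; rewrite bernsteinE /bern; apply: eq_bigr => j _.
  have jm : (j <= m)%N by rewrite -ltnS.
  have := @ecdf_cells _ _ _ _ _ _ X m0 w (inord j); rewrite inordE // => /(_ jm) H.
  by rewrite H.
(* The Bernstein polynomial sees the sample only through its cells, so the event is a finite union
   of fibres of [cells]. *)
rewrite (_ : [set w | _] = [set w | bad (cells m X w)]); last first.
  by apply/seteqP; split=> w /=; rewrite bernY.
rewrite (measure_fibers P) => [|g]; last exact: measurable_cells.
rewrite (eq_bigr _ (fun g _ => cells_law hX m0 g)).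
rewrite sumEFin lee_fin.
have -> : alpha = 2 * expR (- (2 * n%:R * e ^+ 2)).
  rewrite eE expRN lnK ?posrE ?divr_gt0 // invf_div mulrC divfK //.
have p0 i : 0 <= p i by exact: cell_prob_ge0.
have p1 : \sum_i p i = 1 by exact: sum_cell_prob1.
apply: le_trans (two_sided_bound n0 e0 p0 p1).
rewrite big_mkcond [leRHS]big_mkcond; apply: ler_sum => g _.
have pg : 0 <= \prod_r p (g r) by apply: prodr_ge0 => r _; exact: cell_prob_ge0.
case: ifPn => [bg|_]; last by case: ifP.
(* By contraposition: if every grid deviation is below [n e], the supremum norm is at most [t]. *)
rewrite ifT //; apply: contraLR bg; rewrite negb_exists => /forallP H.
rewrite /bad -leNgt; apply: ge_ereal_sup => _ [x + <-].
rewrite /= in_itv /= => x01; rewrite lee_fin -te.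
apply: bern_deviation => // [j jm|].
  have := H (inord j); rewrite -ltNge (mass_cell_prob _ hF) ?inordE // => /ltW.
  have -> : (rank (inord j) g)%:R - n%:R * F (j%:R / m%:R) =
      n%:R * (Y g j - F (j%:R / m%:R)).
    by rewrite /Y; field; rewrite gt_eqF.
  by rewrite normrM ger0_norm // ler_pM2l.
have : ((`|(m ^_ k)%:R / m%:R ^+ k * kantorovich m k (derive01n k F) x
    - derive01n k F x|)%:E
  <= (2^-1 * threshold k alpha m / Num.sqrt n%:R)%:E)%E.
  by apply: le_trans hbias; apply: ereal_sup_ubound; exists x.
by rewrite lee_fin.
Qed.
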